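(* Let $\vec\omega:I\to\mathbb R^3$ be a differentiable vector-valued function on an interval $I\subseteq\mathbb R$ containing $0$, put $\vec\omega_0=\vec\omega(0)$, and let $f:\mathbb R_+^*\to\mathbb R$ satisfy conditions ensuring existence and uniqueness of the solution of the second Cauchy problem below. Then the solution of the Cauchy problem $$\ddot{\vec r}+2\vec\omega\times\dot{\vec r}+\vec\omega\times(\vec\omega\times\vec r)+\dot{\vec\omega}\times\vec r+f(r)\frac{\vec r}{r}=\vec 0,\qquad \vec r(0)=\vec r_0,\quad\dot{\vec r}(0)=\vec v_0,$$ is obtained by applying the rotation tensor $F_{-\omega}$ with angular velocity $-\vec\omega$ to the solution of the problem $$\ddot{\vec r}+f(r)\frac{\vec r}{r}=\vec 0,\qquad \vec r(0)=\vec r_0,\quad\dot{\vec r}(0)=\vec v_0+\vec\omega_0\times\vec r_0 .$$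
   Context: Vectors are in oriented Euclidean three-space, $r=\|\vec r\|$, $\mathbb R_+^*=(0,\infty)$, the dot denotes $d/dt$. $\widetilde\omega(t)$ is the skew-symmetric $3\times3$ matrix (tensor) with $\widetilde\omega(t)\vec x=\vec\omega(t)\times\vec x$. The rotation tensor with angular velocity $-\vec\omega$ is $F_{-\omega}(\vec r)(t)=Q(t)\vec r(t)$, where $Q$ is the unique solution of $\dot Q=-\widetilde\omega Q$, $Q(0)=I_3$ (a proper orthogonal matrix for every $t$). *)

(* Defs.v *)
From HB Require Import structures.
From mathcomp Require Import all_boot all_order all_algebra.
From mathcomp Require Import all_classical all_reals all_analysis.
Set Implicit Arguments.
Unset Strict Implicit.
Unset Printing Implicit Defensive.
Import Order.TTheory GRing.Theory Num.Theory numFieldNormedType.Exports.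
Local Open Scope classical_set_scope.
Local Open Scope ring_scope.

Section Derivative.
Variables (R : realType) (V : normedModType R).

Definition diff_quotient (g : R -> V) (t : R) : R -> V :=
  fun s => (s - t)^-1 *: (g s - g t).

(* The limits are taken with s in D and s != t, so that the derivative is the
   usual two-sided one in the interior of an interval D and the one-sided one
   at an endpoint belonging to D. *)
Definition derivable_within (D : set R) (g : R -> V) (t : R) : Prop :=
  cvg (diff_quotient g t @ within D t^').

Definition derive_within (D : set R) (g : R -> V) (t : R) : V :=
  lim (diff_quotient g t @ within D t^').

Definition derivable_on (D : set R) (g : R -> V) : Prop :=
  forall t, D t -> derivable_within D g t.

End Derivative.

Section Space.
Variable R : realType.
Local Notation vec := 'cV[R]_3.
Implicit Types u v w x : vec.

Definition cross u v : vec :=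
  \col_i [:: u 1 0 * v 2 0 - u 2 0 * v 1 0;
             u 2 0 * v 0 0 - u 0 0 * v 2 0;
             u 0 0 * v 1 0 - u 1 0 * v 0 0]`_i.

(* The library norm `|x| on matrices is the sup norm. *)
Definition enorm x : R := Num.sqrt (\sum_i x i 0 ^+ 2).

Definition skew w : 'M[R]_3 :=
  \matrix_(i, j) (nth [::] [:: [:: 0; - w 2 0; w 1 0];
                              [:: w 2 0; 0; - w 0 0];
                              [:: - w 1 0; w 0 0; 0]] i)`_j.

Lemma skew_tr w : (skew w)^T = - skew w.
Proof.
by apply/matrixP => -[[|[|[|//]]] ?] [[|[|[|//]]] ?];
  rewrite !mxE /= ?opprK ?oppr0.
Qed.

Lemma skewE w x : skew w *m x = cross w x.
Proof.
apply/matrixP => i j; rewrite (ord1 j) !mxE !big_ord_recl big_ord0 !mxE.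
have -> : lift ord0 ord0 = 1 :> 'I_3 by exact/val_inj.
have -> : lift ord0 (lift ord0 ord0) = 2 :> 'I_3 by exact/val_inj.
case: i => [[|[|[|//]]] ?]; rewrite /= !(mul0r, add0r, addr0, mulNr) //.
- by rewrite addrC.
- by rewrite addrC.
Qed.

End Space.

Section Motion.
Variable R : realType.
Local Notation vec := 'cV[R]_3.
Implicit Types (I J : set R) (omega r : R -> vec) (f : R -> R).

(* Q is the matrix function of the rotation tensor with angular velocity
   - omega: Q' = - skew omega *m Q on I and Q 0 is the identity. *)
Definition rotation_matrix I omega (Q : R -> 'M[R]_3) : Prop :=
  [/\ derivable_on I Q,
      forall t, I t -> derive_within I Q t = - skew (omega t) *m Q t
    & Q 0 = 1%:M].

Definition rotate (Q : R -> 'M[R]_3) r : R -> vec := fun t => Q t *m r t.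

(* f is a function on the positive reals: it is only evaluated at enorm x for
   x != 0, since solutions are required below not to pass through the origin. *)
Definition central_term f (x : vec) : vec :=
  f (enorm x) *: ((enorm x)^-1 *: x).

Definition twice_derivable_on J r : Prop :=
  derivable_on J r /\ derivable_on J (derive_within J r).

(* omega is given on I, and the motion r on the subinterval J of I. *)
Definition rotating_frame_problem I J omega f (r0 v0 : vec) r : Prop :=
  let r' := derive_within J r in
  let r'' := derive_within J r' in
  let omega' := derive_within I omega in
  [/\ twice_derivable_on J r,
      forall t, J t -> r t != 0,
      forall t, J t ->
        r'' t + 2 *: cross (omega t) (r' t)
          + cross (omega t) (cross (omega t) (r t))
          + cross (omega' t) (r t) + central_term f (r t) = 0,
      r 0 = r0
    & r' 0 = v0].

Definition central_force_problem J f (r0 v0 : vec) r : Prop :=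
  let r' := derive_within J r in
  let r'' := derive_within J r' in
  [/\ twice_derivable_on J r,
      forall t, J t -> r t != 0,
      forall t, J t -> r'' t + central_term f (r t) = 0,
      r 0 = r0
    & r' 0 = v0].

(* Functions on J are represented by total ones, whose values off J are
   irrelevant; hence uniqueness means equality on J. *)
Definition unique_solution_on J (P : (R -> vec) -> Prop) r : Prop :=
  P r /\ forall s, P s -> forall t, J t -> s t = r t.

End Motion.

(* Main.v *)
Require Import Defs.
From mathcomp Require Import all_boot all_order all_algebra.
From mathcomp Require Import all_classical all_reals all_analysis.
Import Order.TTheory GRing.Theory Num.Theory numFieldNormedType.Exports.
Local Open Scope classical_set_scope.
Local Open Scope ring_scope.
Set Implicit Arguments.
Unset Strict Implicit.
Unset Printing Implicit Defensive.

(** Write [W] for the skew matrix of [omega] and [nabla y = y' + W y] for the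
derivative seen from the moving frame.  Two facts carry the proof.

Expanding the square of [nabla] gives
[nabla (nabla y) = y'' + 2 omega x y' + omega x (omega x y) + omega' x y], so
the equation in the rotating frame is [nabla (nabla y) + central y = 0]
([rotating_accelerationE]): the Coriolis, centripetal and Euler terms are just
the inertial acceleration.

The rotation [Q] intertwines [nabla] with the ordinary derivative.  Indeed
[Q' = - W Q] gives [nabla (Q x) = Q x'], and transposing it, with [W] skew, gives
[(Q^T)' = Q^T W], hence [(Q^T y)' = Q^T (nabla y)]
([is_derive_within_rotate], [is_derive_within_unrotate]).  The two formulas for
[Q] and [Q^T] also show that [Q^T Q] has zero derivative, so that [Q] is
orthogonal on the whole interval ([rotation_orthogonal]) and commutes with the
central force, which depends on the vector only through its length and direction
([central_term_orthogonal]).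

Applying the intertwining twice, [Q] maps solutions of the central force problem
to solutions of the rotating frame problem ([rotate_solution]) and [Q^T] maps
them back ([unrotate_solution]); the initial velocities correspond since
[Q 0 = 1] and [nabla y] is [v0 + omega_0 x r0] at time 0.  The two maps are
inverse to each other, so uniqueness for the first problem gives uniqueness for
the second.

Derivatives are limits within an interval which may contain its endpoints, so
they are one-sided there; the sum and product rules, and the constancy of a
function whose derivative vanishes, are established for them below. *)

(** * Vector algebra in three-space *)

Section EuclideanSpace.
Variable R : realType.
Implicit Types u v x : 'cV[R]_3.

Lemma skewB u v : Defs.skew (u - v) = Defs.skew u - Defs.skew v.
Proof.
apply/matrixP => -[[|[|[|//]]] ?] [[|[|[|//]]] ?];
  by rewrite !mxE /= ?mxE ?opprB ?opprK ?subrr ?opprD ?opprK // addrC.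
Qed.

Lemma skewZ c u : Defs.skew (c *: u) = c *: Defs.skew u.
Proof.
by apply/matrixP => -[[|[|[|//]]] ?] [[|[|[|//]]] ?];
  rewrite !mxE /= ?mxE ?mulr0 ?mulrN.
Qed.

(** With [y1] and [y2] the first two derivatives of [y], the right-hand side is
    the derivative of [y1 + w x y] plus [w] times it: one Coriolis term comes
    from differentiating [w x y], the other from the outer [w]. *)
Lemma rotating_accelerationE (y y1 y2 w w' : 'cV[R]_3) :
  y2 + 2 *: cross w y1 + cross w (cross w y) + cross w' y =
  (y2 + (Defs.skew w' *m y + Defs.skew w *m y1)) +
  Defs.skew w *m (y1 + Defs.skew w *m y).
Proof.
rewrite -!skewE mulmxDr scaler_nat mulr2n -!addrA; congr (_ + _).
by rewrite [RHS]addrC -!addrA.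
Qed.

Lemma enorm_orthogonal (P : 'M[R]_3) x :
  P^T *m P = 1%:M -> enorm (P *m x) = enorm x.
Proof.
move=> PP; suff sqE (z : 'cV[R]_3) : \sum_i z i 0 ^+ 2 = (z^T *m z) 0 0.
  by rewrite /enorm !sqE trmx_mul -mulmxA [P^T *m _]mulmxA PP mul1mx.
by rewrite mxE; apply: eq_bigr => i _; rewrite mxE expr2.
Qed.

(** This isotropy of a central force is what makes the force term the same in
    both frames. *)
Lemma central_term_orthogonal f (P : 'M[R]_3) x :
  P^T *m P = 1%:M -> central_term f (P *m x) = P *m central_term f x.
Proof. by move=> PP; rewrite /central_term enorm_orthogonal // !scalemxAr. Qed.

Lemma orthogonal_neq0 (P : 'M[R]_3) (x : 'cV[R]_3) :
  P^T *m P = 1%:M -> x != 0 -> P *m x != 0.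
Proof.
move=> PP; apply: contra_neq => Px0.
by rewrite -[x]mul1mx -PP -mulmxA Px0 mulmx0.
Qed.

End EuclideanSpace.

(** * Limits of matrix-valued functions *)

Section MatrixLimits.
Variables (R : realType) (T : Type) (F : set_system T).
Hypothesis FF : Filter F.

(** A neighbourhood of a matrix contains a product of neighbourhoods of its
    entries, and there are finitely many entries. *)
Lemma cvg_mxP m n (A : T -> 'M[R]_(m, n)) (L : 'M[R]_(m, n)) :
  A s @[s --> F] --> L <-> forall i j, A s i j @[s --> F] --> L i j.
Proof.
split=> [AL i j|AL].
  exact: cvg_comp AL (@coord_continuous _ _ _ i j L).
move=> P [U LU UP].
have : \forall s \near F, forall ij : 'I_m * 'I_n, U ij.1 ij.2 (A s ij.1 ij.2).
  by apply: filter_forall => -[i j]; exact: (AL i j _ (LU i j)).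
by apply: filterS => s Us; apply: UP => i j; exact: (Us (i, j)).
Qed.

Lemma cvg_mulmx m n p (A : T -> 'M[R]_(m, n))
    (B : T -> 'M[R]_(n, p)) (a : 'M[R]_(m, n)) (b : 'M[R]_(n, p)) :
  A s @[s --> F] --> a -> B s @[s --> F] --> b ->
  A s *m B s @[s --> F] --> a *m b.
Proof.
move=> /cvg_mxP Aa /cvg_mxP Bb; apply/cvg_mxP => i j.
under eq_fun do rewrite mxE.
rewrite mxE; apply: cvg_big => [|k _]; first exact: add_continuous.
exact: cvgM (Aa i k) (Bb k j).
Qed.

Lemma cvg_trmx m n (A : T -> 'M[R]_(m, n)) (a : 'M[R]_(m, n)) :
  A s @[s --> F] --> a -> (A s)^T @[s --> F] --> a^T.
Proof.
move=> /cvg_mxP Aa; apply/cvg_mxP => i j; rewrite mxE.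
by under eq_fun do rewrite mxE; exact: Aa.
Qed.

Lemma cvg_skew (w : T -> 'cV[R]_3) (a : 'cV[R]_3) :
  w s @[s --> F] --> a -> Defs.skew (w s) @[s --> F] --> Defs.skew a.
Proof.
move=> /cvg_mxP wa; apply/cvg_mxP => i j; rewrite mxE.
under eq_fun => s do rewrite /Defs.skew mxE.
by case: i j => [[|[|[|//]]] ?] [[|[|[|//]]] ?] /=;
  first [exact: cvg_cst | exact: wa | apply: cvgN; exact: wa].
Qed.

End MatrixLimits.

(** * Differentiation within an interval *)

Definition is_derive_within {R : realType} {V : normedModType R}
    (D : set R) (g : R -> V) (t : R) (l : V) : Prop :=
  diff_quotient g t s @[s --> within D t^'] --> l.

(** In an interval not reduced to [t], some one-sided neighbourhood of [t] lies
    in [D], so the limit defining the derivative at [t] is not vacuous, hence is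
    unique. *)
Lemma within_dnbhs_proper (R : realType) (D : set R) (t : R) :
  is_interval D -> D t -> (exists2 u, D u & u != t) ->
  ProperFilter (within D t^').
Proof.
move=> Ditv Dt [u Du]; rewrite neq_lt => ut; split; last exact: within_filter.
have [side [side_proper side_sub sideD]] : exists G : set_system R,
    [/\ ProperFilter G, t^' `<=` G & G D].
  case/orP: ut => [ut|tu].
  - exists t^'-; split; first exact: at_left_proper_filter.
      by move=> A; rewrite /dnbhs /at_left /within /=; apply: filterS => s As st;
        apply: As; rewrite lt_eqF.
    near=> s; apply: (Ditv u t) => //; apply/andP; split.
      by near: s; exact: nbhs_left_ge.
    by near: s; exact: nbhs_left_le.
  - exists t^'+; split; first exact: at_right_proper_filter.
      by move=> A; rewrite /dnbhs /at_right /within /=; apply: filterS => s As st;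
        apply: As; rewrite gt_eqF.
    near=> s; apply: (Ditv t u) => //; apply/andP; split.
      by near: s; exact: nbhs_right_ge.
    by near: s; exact: nbhs_right_le.
(* If the empty set were in the filter, points of [D] near [t] would be excluded,
   contrary to what happens on the chosen side. *)
rewrite /within => D0; apply: (@filter_not_empty _ side).
have := side_sub _ D0; apply: filterS2 sideD => s Ds; exact.
Unshelve. all: by end_near. Qed.

Section WithinCalculus.
Variables (R : realType) (D : set R).
Implicit Types (V : normedModType R) (t : R).

Lemma is_derive_withinP V (g : R -> V) t l :
  ProperFilter (within D t^') ->
  is_derive_within D g t l <->
  derivable_within D g t /\ derive_within D g t = l.
Proof.
move=> Dt; split=> [dg|[dg <-]]; last exact: dg.
by split; [exact: cvgP dg | exact: cvg_lim dg].
Qed.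

(** The point [t] has to lie in [D] because its own value enters the difference
    quotient.  This allows the first derivative to be replaced by a formula known
    only on the interval before it is differentiated again. *)
Lemma eq_is_derive_within V (g h : R -> V) t l : D t ->
  (forall s, D s -> g s = h s) ->
  is_derive_within D g t l -> is_derive_within D h t l.
Proof.
move=> Dt gh; apply: cvg_trans; apply: near_eq_cvg.
rewrite near_withinE; apply: filterE => s Ds.
by rewrite /diff_quotient !gh.
Qed.

Lemma sub_is_derive_within V (E : set R) (g : R -> V) t l :
  D `<=` E -> is_derive_within E g t l -> is_derive_within D g t l.
Proof.
move=> DE; apply: cvg_trans; apply: cvg_app => A EA.
change (\forall s \near t^', D s -> A s).
have : \forall s \near t^', E s -> A s by [].
by apply: filterS => s As /DE.
Qed.

Lemma is_derive_within_cvg V (g : R -> V) t l :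
  is_derive_within D g t l -> g s @[s --> within D t^'] --> g t.
Proof.
move=> dg.
have gE : (fun s => (s - t) *: diff_quotient g t s + g t) = g.
  apply/funext => s; rewrite /diff_quotient scalerA.
  have [->|st] := eqVneq s t; first by rewrite !subrr scaler0 add0r.
  by rewrite divff ?subr_eq0 // scale1r subrK.
rewrite -[X in X s @[s --> _]]gE -[X in _ --> X]add0r.
rewrite -[X in _ --> X + _](scale0r l).
apply: cvgD; last exact: cvg_cst.
apply: cvgZ dg; rewrite -[X in _ --> X](subrr t).
apply: cvgB; last exact: cvg_cst.
move=> A /nbhs_dnbhs tA; change (\forall s \near t^', D s -> A s).
by apply: filterS tA => s As _.
Qed.

Lemma is_derive_withinD V (g h : R -> V) t a b :
  is_derive_within D g t a -> is_derive_within D h t b ->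
  is_derive_within D (fun s => g s + h s) t (a + b).
Proof.
move=> dg dh; rewrite /is_derive_within.
have -> : diff_quotient (fun s => g s + h s) t =
    fun s => diff_quotient g t s + diff_quotient h t s.
  by apply/funext => s; rewrite /diff_quotient -scalerDr opprD addrACA.
exact: cvgD.
Qed.

Lemma is_derive_withinN V (g : R -> V) t a :
  is_derive_within D g t a -> is_derive_within D (fun s => - g s) t (- a).
Proof.
move=> dg; rewrite /is_derive_within.
have -> : diff_quotient (fun s => - g s) t = fun s => - diff_quotient g t s.
  by apply/funext => s; rewrite /diff_quotient -scalerN opprD.
exact: cvgN.
Qed.

(** The identity between difference quotients used here is exact for every [s],
    even for [s = t]; the factor [B s] tends to [B t] because [B], being
    differentiable, is continuous within [D]. *)
Lemma is_derive_within_mulmx m n p (A : R -> 'M[R]_(m, n))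
    (B : R -> 'M[R]_(n, p)) t a b :
  is_derive_within D A t a -> is_derive_within D B t b ->
  is_derive_within D (fun s => A s *m B s) t (a *m B t + A t *m b).
Proof.
move=> dA dB; rewrite /is_derive_within.
have -> : diff_quotient (fun s => A s *m B s) t =
    fun s => diff_quotient A t s *m B s + A t *m diff_quotient B t s.
  apply/funext => s; rewrite /diff_quotient -scalemxAl -scalemxAr -scalerDr.
  by rewrite mulmxBl mulmxBr addrA subrK.
apply: cvgD.
  by apply: cvg_mulmx => //; exact: is_derive_within_cvg dB.
by apply: cvg_mulmx => //; exact: cvg_cst.
Qed.

Lemma is_derive_within_trmx m n (A : R -> 'M[R]_(m, n)) t a :
  is_derive_within D A t a -> is_derive_within D (fun s => (A s)^T) t a^T.
Proof.
move=> dA; rewrite /is_derive_within.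
have -> : diff_quotient (fun s => (A s)^T) t = fun s => (diff_quotient A t s)^T.
  by apply/funext => s; apply/matrixP => i j; rewrite /diff_quotient !mxE.
exact: cvg_trmx.
Qed.

Lemma is_derive_within_skew (w : R -> 'cV[R]_3) t a :
  is_derive_within D w t a ->
  is_derive_within D (fun s => Defs.skew (w s)) t (Defs.skew a).
Proof.
move=> dw; rewrite /is_derive_within.
have -> : diff_quotient (fun s => Defs.skew (w s)) t =
    fun s => Defs.skew (diff_quotient w t s).
  by apply/funext => s; rewrite /diff_quotient skewZ skewB.
exact: cvg_skew.
Qed.

Lemma is_derive_within_entry m n (A : R -> 'M[R]_(m, n)) t a i j :
  is_derive_within D A t a -> is_derive_within D (fun s => A s i j) t (a i j).
Proof.
move=> /cvg_mxP/(_ i j); rewrite /is_derive_within.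
by under eq_fun do rewrite /diff_quotient !mxE.
Qed.

End WithinCalculus.

(** The two-sided derivative of the library is a limit of increments [e] at [0];
    the translation by [t] turns it into the limit at [t] used here. *)
Lemma is_derive_within_interior (R : realType) (V : normedModType R)
    (D : set R) (g : R -> V) (t : R) (l : V) :
  nbhs t D -> is_derive_within D g t l -> is_derive t 1 g l.
Proof.
move=> tD dg.
suff dl : e^-1 *: (g (e *: 1 + t) - g t) @[e --> 0^'] --> l.
  by apply: DeriveDef; [exact: cvgP dl | exact: cvg_lim dl].
have -> : (fun e => e^-1 *: (g (e *: 1 + t) - g t)) =
    diff_quotient g t \o (fun e => e + t).
  by apply/funext => e; rewrite /diff_quotient /= addrK [_ *: 1]mulr1.
suff sh : e + t @[e --> 0^'] --> within D t^' by exact: cvg_comp sh dg.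
move=> A DA.
have {}DA : \forall s \near t, s != t -> D s -> A s by exact: DA.
have : \forall s \near t, s != t -> A s.
  by apply: filterS2 tD DA => s Ds + st; apply.
rewrite (near_shift 0) subr0 => tA.
change (\forall e \near 0, e != 0 -> A (e + t)).
apply: filterS tA => e /= eA e0; apply: eA.
by rewrite -subr_eq0 addrK.
Qed.

(** The mean value theorem on [[a, b]] needs differentiability in the interior
    only, and continuity at the endpoints is one-sided, so derivatives within [D]
    suffice. *)
Lemma is_derive_within0_cst (R : realType) (D : set R) (h : R -> R) :
  is_interval D -> (forall t, D t -> is_derive_within D h t 0) ->
  forall a b, D a -> D b -> h a = h b.
Proof.
move=> Ditv dh a b; wlog ab : a b / a < b => [H Da Db|].
  have [ab|ba|->//] := ltgtP a b; first exact: H.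
  by apply/esym/H.
move=> Da Db.
have abD x : x \in `[a, b]%R -> D x by rewrite in_itv; exact: Ditv.
have hcont : {within `[a, b], continuous h}.
  apply: (@continuous_subspaceW _ _ _ D); first by move=> x; exact: abD.
  apply/subspace_continuousP => x Dx A hxA.
  have hx := is_derive_within_cvg (dh x Dx) hxA.
  have {}hx : \forall s \near x, s != x -> D s -> A (h s) by exact: hx.
  change (\forall s \near x, D s -> A (h s)).
  apply: filterS hx => s; have [-> _ _|sx] := eqVneq s x; last exact.
  exact: nbhs_singleton.
have [x xab|c _ /eqP] := MVT (df := fun=> 0) ab _ hcont.
  have Dx : D x by apply: abD; exact: subset_itv_oo_cc xab.
  apply: is_derive_within_interior (dh x Dx).
  by apply: filterS (near_in_itvoo xab) => y /subset_itv_oo_cc/abD.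
by rewrite mul0r subr_eq0 => /eqP.
Qed.

(** * Moving frames *)

Section Motion.
Variables (R : realType) (J : set R).
Hypothesis J_limit : forall t, J t -> ProperFilter (within J t^').

(** The second derivative is the derivative of the function
    [derive_within J r], of which only the values on [J] are known; this is
    enough to compute it. *)
Lemma twice_derivable_onE (r r1 r2 : R -> 'cV[R]_3) :
  (forall t, J t -> is_derive_within J r t (r1 t)) ->
  (forall t, J t -> is_derive_within J r1 t (r2 t)) ->
  [/\ twice_derivable_on J r, {in J, derive_within J r =1 r1} &
      {in J, derive_within J (derive_within J r) =1 r2}].
Proof.
move=> dr dr1.
have r'E t : J t -> derive_within J r t = r1 t.
  by move=> Jt; have [] := (is_derive_withinP r _ (J_limit Jt)).1 (dr t Jt).
have dr' t : J t -> is_derive_within J (derive_within J r) t (r2 t).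
  by move=> Jt; apply: eq_is_derive_within (dr1 t Jt) => // s /r'E.
split=> [|t /set_mem/r'E//|t /set_mem Jt].
  by split=> t Jt; have [] := (is_derive_withinP _ _ (J_limit Jt)).1 (dr t Jt);
   have [] := (is_derive_withinP _ _ (J_limit Jt)).1 (dr' t Jt).
by have [] := (is_derive_withinP _ _ (J_limit Jt)).1 (dr' t Jt).
Qed.

Variables (I : set R) (omega : R -> 'cV[R]_3) (Q : R -> 'M[R]_3).
Hypotheses (J_itv : is_interval J) (J_0 : J 0) (J_sub_I : J `<=` I).
Hypothesis omega_diff : derivable_on I omega.
Hypothesis Q_rot : rotation_matrix I omega Q.

Local Notation W t := (Defs.skew (omega t)).
Local Notation W' t := (Defs.skew (derive_within I omega t)).

(** The derivative of [Q] is prescribed within [I], while the motions are only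
    defined on [J]; within the smaller set the same limit holds. *)
Lemma is_derive_within_rotation t :
  J t -> is_derive_within J Q t (- W t *m Q t).
Proof.
move=> Jt; have [dQ QE _] := Q_rot; apply: (sub_is_derive_within J_sub_I).
by rewrite -QE; [exact: dQ (J_sub_I Jt) | exact: J_sub_I].
Qed.

Lemma is_derive_within_angular t :
  J t -> is_derive_within J (fun s => W s) t (W' t).
Proof.
move=> Jt; apply: is_derive_within_skew; apply: (sub_is_derive_within J_sub_I).
exact: omega_diff (J_sub_I Jt).
Qed.

(** Transposition reverses the product and changes the sign of the skew matrix,
    which cancels the sign of the angular velocity. *)
Lemma is_derive_within_rotation_tr t :
  J t -> is_derive_within J (fun s => (Q s)^T) t ((Q t)^T *m W t).
Proof.
move=> Jt; have := is_derive_within_trmx (is_derive_within_rotation Jt).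
by rewrite trmx_mul linearN /= skew_tr opprK.
Qed.

(** The derivative [Q^T W Q + Q^T (- W Q)] of [Q^T Q] vanishes, and [Q^T Q] is the
    identity at time 0. *)
Lemma rotation_orthogonal t : J t -> (Q t)^T *m Q t = 1%:M.
Proof.
move=> Jt; have [_ _ Q0] := Q_rot; apply/matrixP => i j.
have -> : 1%:M = (Q 0)^T *m Q 0 by rewrite Q0 trmx1 mulmx1.
apply: (is_derive_within0_cst (h := fun s => ((Q s)^T *m Q s) i j) J_itv _ Jt J_0).
move=> s Js.
have := is_derive_within_mulmx (is_derive_within_rotation_tr Js)
  (is_derive_within_rotation Js).
rewrite mulmxA mulmxN mulNmx subrr => /(is_derive_within_entry (i := i) (j := j)).
by rewrite mxE.
Qed.

Lemma rotation_tr_orthogonal t : J t -> Q t *m (Q t)^T = 1%:M.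
Proof. by move=> /rotation_orthogonal/mulmx1C. Qed.

(** Adding [W t *m rotate Q x t] to this derivative gives [Q t *m a]: in the
    moving frame, the derivative of [Q x] is the rotated derivative of [x]. *)
Lemma is_derive_within_rotate x a t : J t -> is_derive_within J x t a ->
  is_derive_within J (rotate Q x) t (Q t *m a - W t *m rotate Q x t).
Proof.
move=> Jt dx.
have := is_derive_within_mulmx (is_derive_within_rotation Jt) dx.
by rewrite !mulNmx -mulmxA addrC.
Qed.

(** The converse intertwining.  It is stated separately, rather than deduced from
    [is_derive_within_rotate], because it has to provide the differentiability of
    [Q^T y]. *)
Lemma is_derive_within_unrotate y a t : J t -> is_derive_within J y t a ->
  is_derive_within J (rotate (fun s => (Q s)^T) y) t
    ((Q t)^T *m (a + W t *m y t)).
Proof.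
move=> Jt dy.
have := is_derive_within_mulmx (is_derive_within_rotation_tr Jt) dy.
by rewrite -mulmxA -mulmxDr addrC.
Qed.

Lemma is_derive_within_cross (y : R -> 'cV[R]_3) (a : 'cV[R]_3) t :
  J t -> is_derive_within J y t a ->
  is_derive_within J (fun s => W s *m y s) t (W' t *m y t + W t *m a).
Proof. by move=> Jt; exact: is_derive_within_mulmx (is_derive_within_angular Jt). Qed.

(** Both [nabla y = Q x'] and [nabla (nabla y) = Q x''] for [y = Q x], so the left
    side of the rotating equation is [Q] applied to that of the central one. *)
Lemma rotate_solution f r0 v0 x :
  central_force_problem J f r0 (v0 + cross (omega 0) r0) x ->
  rotating_frame_problem I J omega f r0 v0 (rotate Q x).
Proof.
move=> [[dx dx'] x_neq0 x_eq x0 x'0]; have [_ _ Q0] := Q_rot.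
set x' := derive_within J x in dx' x_eq x'0.
set x'' := derive_within J x' in x_eq.
pose y := rotate Q x; pose y1 t := Q t *m x' t - W t *m y t.
have dy t : J t -> is_derive_within J y t (y1 t).
  by move=> Jt; exact: is_derive_within_rotate (dx t Jt).
have dy1 t : J t -> is_derive_within J y1 t
    (Q t *m x'' t - W t *m (Q t *m x' t) - (W' t *m y t + W t *m y1 t)).
  move=> Jt; apply: is_derive_withinD.
    exact: is_derive_within_rotate (dx' t Jt).
  exact: is_derive_withinN (is_derive_within_cross Jt (dy t Jt)).
have [dyy yE y1E] := twice_derivable_onE dy dy1.
split=> //.
- by move=> t Jt; apply: orthogonal_neq0 (x_neq0 t Jt); exact: rotation_orthogonal.
- move=> t Jt; rewrite rotating_accelerationE yE ?y1E ?inE //.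
  rewrite /y1 -/y !subrK central_term_orthogonal; last exact: rotation_orthogonal.
  by rewrite -mulmxDr x_eq // mulmx0.
- by rewrite /rotate Q0 mul1mx.
- by rewrite yE ?inE // /y1 /y /rotate Q0 !mul1mx x0 x'0 -skewE addrK.
Qed.

(** For [z = nabla y], the first two derivatives of [Q^T y] are [Q^T z] and
    [Q^T (nabla z)]. *)
Lemma unrotate_solution f r0 v0 y :
  rotating_frame_problem I J omega f r0 v0 y ->
  central_force_problem J f r0 (v0 + cross (omega 0) r0)
    (rotate (fun s => (Q s)^T) y).
Proof.
move=> [[dy dy'] y_neq0 y_eq y0 y'0]; have [_ _ Q0] := Q_rot.
set y' := derive_within J y in dy' y_eq y'0.
set y'' := derive_within J y' in y_eq.
have {}dy t : J t -> is_derive_within J y t (y' t) by exact: dy.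
pose z t := y' t + W t *m y t.
have dz t : J t -> is_derive_within J z t (y'' t + (W' t *m y t + W t *m y' t)).
  move=> Jt; apply: is_derive_withinD (dy' t Jt) _.
  exact: is_derive_within_cross (dy t Jt).
have [dxx xE x1E] := twice_derivable_onE
  (fun t Jt => is_derive_within_unrotate Jt (dy t Jt))
  (fun t Jt => is_derive_within_unrotate Jt (dz t Jt)).
split=> //.
- move=> t Jt; apply: orthogonal_neq0 (y_neq0 t Jt).
  by rewrite trmxK rotation_tr_orthogonal.
- move=> t Jt; rewrite x1E ?inE // -rotating_accelerationE.
  rewrite central_term_orthogonal; last by rewrite trmxK rotation_tr_orthogonal.
  by rewrite -mulmxDr y_eq // mulmx0.
- by rewrite /rotate Q0 trmx1 mul1mx.
- by rewrite xE ?inE // Q0 trmx1 mul1mx y0 y'0 skewE.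
Qed.

End Motion.

Theorem mainTheorem16 (R : realType) (I J : set R)
    (omega : R -> 'cV[R]_3) (f : R -> R) (r0 v0 : 'cV[R]_3)
    (I_itv : is_interval I) (I_0 : I 0) (omega_diff : derivable_on I omega)
    (J_itv : is_interval J) (J_0 : J 0) (J_nondeg : exists2 t, J t & t != 0)
    (J_sub_I : J `<=` I)
    (f_wellposed : exists q : R -> 'cV[R]_3,
      unique_solution_on J
        (central_force_problem J f r0 (v0 + cross (omega 0) r0)) q)
    (Q : R -> 'M[R]_3) (Q_rot : rotation_matrix I omega Q)
    (r : R -> 'cV[R]_3)
    (r_sol : central_force_problem J f r0 (v0 + cross (omega 0) r0) r) :
  unique_solution_on J (rotating_frame_problem I J omega f r0 v0) (rotate Q r).
Proof.
have J_limit t : J t -> ProperFilter (within J t^').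
  move=> Jt; apply: within_dnbhs_proper => //.
  have [->//|t0] := eqVneq t 0.
  by exists 0 => //; rewrite eq_sym.
split; first exact: (rotate_solution J_limit J_itv J_0 J_sub_I omega_diff).
(* Any other solution [s] rotates back to a solution of the central force problem,
   so that [Q^T s] and [r] agree on [J]. *)
move=> s /(unrotate_solution J_limit J_itv J_0 J_sub_I omega_diff Q_rot) s_sol.
move=> t Jt; have [q [_ q_uniq]] := f_wellposed.
rewrite [in RHS]/rotate (q_uniq _ r_sol t Jt) -(q_uniq _ s_sol t Jt).
by rewrite /rotate mulmxA (rotation_tr_orthogonal J_itv J_0 J_sub_I Q_rot Jt) mul1mx.
Qed.
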